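(* Let $k\ge1$, let $H_0\in\mathbb{R}^{n\times n}$ be symmetric, and let $H_0$ be updated $k$ times by means of the Kleinmichel formula $$H_{j+1}=\gamma_j\left[H_j+\frac{(y^j-\gamma_jH_jd^j)(y^j-\gamma_jH_jd^j)^\top}{\gamma_j\,\langle y^j-\gamma_jH_jd^j,\,d^j\rangle}\right],\qquad j=0,\dots,k-1,$$ using pairs $\{d^j,y^j\}_{j=0}^{k-1}$ of vectors in $\mathbb{R}^n$ and parameters $\gamma_j>0$, and assume that each update is well-defined, i.e., $\langle y^j-\gamma_jH_jd^j,d^j\rangle\ne0$ for $j=0,\dots,k-1$. Then the resulting matrix $H_k$ is given by $$H_k=\overline\gamma_kH_0+Q_kM_k^{-1}Q_k^\top,$$ where $\overline\gamma_j:=\prod_{i=0}^{j-1}\gamma_i$ for $j\ge1$, $Q_j:=[q^0,\dots,q^{j-1}]\in\mathbb{R}^{n\times j}$ with columns $q^j:=y^j-\overline\gamma_{j+1}H_0d^j$, and the nonsingular matrix $M_k$ is defined recursively by $$M_1=\langle q^0,d^0\rangle,\qquad M_{j+1}=\begin{bmatrix}\gamma_j^{-1}M_j & Q_j^\top d^j\\ (Q_j^\top d^j)^\top & \langle q^j,d^j\rangle\end{bmatrix},\quad j\ge1 .$$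
   Context: $\langle\cdot,\cdot\rangle$ is the Euclidean inner product on $\mathbb{R}^n$. In matrix form, with $S_k=[d^0\ \cdots\ d^{k-1}]$ and $Y_k=[y^0\ \cdots\ y^{k-1}]$ in $\mathbb{R}^{n\times k}$, one has $Q_k=Y_k-H_0S_k\,\mathrm{diag}(\overline\gamma_1,\dots,\overline\gamma_k)$. In the paper's application the $d^j$ are steps and $y^j$ are the corresponding gradient differences of a smooth function, but only the pairs themselves enter the statement. *)

(* Defs.v *)
From mathcomp Require Import all_boot all_order all_algebra.
From mathcomp Require Import reals.
Set Implicit Arguments.
Unset Strict Implicit.
Unset Printing Implicit Defensive.
Import Order.TTheory GRing.Theory Num.Theory.
Local Open Scope ring_scope.

Definition inner (R : realType) (n : nat) (u v : 'cV[R]_n) : R :=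
  \sum_(i < n) u i 0 * v i 0.

(* Vectors of R^n are column vectors. The data d, y, gamma are sequences indexed
   by nat; for k updates only the terms of index j < k are ever used. *)
Section Kleinmichel.
Variables (R : realType) (n : nat) (H0 : 'M[R]_n).
Variables (d y : nat -> 'cV[R]_n) (gamma : nat -> R).

Definition residual (H : 'M[R]_n) (j : nat) : 'cV[R]_n :=
  y j - gamma j *: (H *m d j).

Fixpoint kleinmichel (j : nat) : 'M[R]_n :=
  match j with
  | 0 => H0
  | i.+1 =>
      let H := kleinmichel i in
      let r := residual H i in
      gamma i *: (H + (gamma i * inner r (d i))^-1 *: (r *m r^T))
  end.

Definition gamma_bar (j : nat) : R := \prod_(i < j) gamma i.

Definition qvec (j : nat) : 'cV[R]_n :=
  y j - gamma_bar j.+1 *: (H0 *m d j).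

Definition Qmx (j : nat) : 'M[R]_(n, j) := \matrix_(i < n, l < j) qvec l i 0.

(* The cast identifies the block size j + 1 with j.+1. *)
Definition Mstep (j : nat) (M : 'M[R]_j) : 'M[R]_j.+1 :=
  let v := (Qmx j)^T *m d j in
  castmx (addn1 j, addn1 j)
    (block_mx ((gamma j)^-1 *: M) v
              v^T                 (inner (qvec j) (d j))%:M).

(* The recursion starts at size 1; the value at size 0 is the empty matrix. *)
Fixpoint Mmx (k : nat) : 'M[R]_k :=
  match k with
  | 0 => 0
  | j.+1 =>
      match j return 'M[R]_j -> 'M[R]_j.+1 with
      | 0 => fun _ => (inner (qvec 0) (d 0))%:M
      | i.+1 => @Mstep i.+1
      end (Mmx j)
  end.

End Kleinmichel.

(* Main.v *)
Require Import Defs.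
From mathcomp Require Import all_boot all_order all_algebra.
From mathcomp Require Import reals.
Set Implicit Arguments.
Unset Strict Implicit.
Unset Printing Implicit Defensive.
Import Order.TTheory GRing.Theory Num.Theory.
Local Open Scope ring_scope.

(** The formula is the inverse of a bordered matrix, iterated.  Suppose
    [H_j = gbar_j H_0 + Q M^-1 Q^T] with [M = M_j] symmetric and invertible, and
    write [g = gamma_j], [N = g^-1 M], [v = Q^T d^j] and [w = N^-1 v].  Then
    [g H_j = gbar_(j+1) H_0 + Q N^-1 Q^T], so the residual of the next update is
    [r = y^j - g H_j d^j = q^j - Q w].  By the symmetry of [N], the number
    [<r, d^j> = <q^j, d^j> - w^T v] is the Schur complement of [N] in
    [M_(j+1) = [N, v; v^T, <q^j, d^j>]].  Since it is nonzero, [M_(j+1)] is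
    invertible and its inverse is explicit ([mul_bordered_inv]).  Expanding
    [[Q q^j] M_(j+1)^-1 [Q q^j]^T] with this inverse gives
    [Q N^-1 Q^T + <r, d^j>^-1 r r^T] ([bordered_form]), and the second term is
    the rank-one correction of the update.  The induction starts at [k = 0],
    where [Q] and [M] are empty. *)

Section Bordered.
Variables (F : fieldType) (n m : nat).
Implicit Types (N : 'M[F]_m) (v w : 'cV[F]_m) (Q : 'M[F]_(n, m)) (q : 'cV[F]_n).

(** The inverse of a bordered symmetric matrix: [w] stands for [N^-1 v] and [s]
    for the Schur complement [c - v^T w]. *)
Lemma mul_bordered_inv N v w (c s : F) :
  N \in unitmx -> N^T = N -> s != 0 ->
  N *m w = v -> v^T *m w = (c - s)%:M ->
  block_mx N v v^T c%:M *m
    block_mx (invmx N + s^-1 *: (w *m w^T)) (- s^-1 *: w)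
             (- s^-1 *: w^T) (s^-1)%:M = 1%:M.
Proof.
move=> uN symN s0 Nw vw.
have vN : v^T *m invmx N = w^T.
  by rewrite -Nw trmx_mul symN -mulmxA mulmxV // mulmx1.
rewrite mulmx_block scalar_mx_block; congr block_mx.
- rewrite mulmxDr mulmxV // -!scalemxAr mulmxA Nw scaleNr addrK //.
- by rewrite -scalemxAr Nw mul_mx_scalar scaleNr addNr.
- rewrite mulmxDr vN -!scalemxAr mulmxA vw !mul_scalar_mx !scalerA.
  rewrite -addrA -scalerDl -[X in X + _]scale1r -scalerDl mulNr -mulrBr.
  by rewrite [c - s]addrC addrK mulrN mulVf // subrr scale0r.
- rewrite -scalemxAr vw scale_scalar_mx -scalar_mxM -raddfD /=.
  congr (_%:M); rewrite mulNr [c * _]mulrC addrC -mulrBr opprB addrCA subrr.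
  by rewrite addr0 mulVf.
Qed.

(** The quadratic form of an inverted bordered matrix on a bordered [Q]; the
    equation [e] lets the size [m + 1] be presented in any other way. *)
Lemma bordered_form m' (e : (m + 1)%N = m') N v w Q q (c s : F) :
  N \in unitmx -> N^T = N -> s != 0 ->
  N *m w = v -> v^T *m w = (c - s)%:M ->
  let B := castmx (e, e) (block_mx N v v^T c%:M) in
  let Qq := castmx (erefl n, e) (row_mx Q q) in
  [/\ B \in unitmx, B^T = B &
      Qq *m invmx B *m Qq^T =
        Q *m invmx N *m Q^T + s^-1 *: ((q - Q *m w) *m (q - Q *m w)^T)].
Proof.
case: m' / e => uN symN s0 Nw vw; rewrite !castmx_id /=.
have BC := mul_bordered_inv uN symN s0 Nw vw.
have [uB _] := mulmx1_unit BC; split=> //.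
  by rewrite tr_block_mx symN trmxK tr_scalar_mx.
rewrite -[invmx _]mulmx1 -BC mulKmx //.
set r := q - Q *m w.
have -> : row_mx Q q *m
    block_mx (invmx N + s^-1 *: (w *m w^T)) (- s^-1 *: w)
             (- s^-1 *: w^T) (s^-1)%:M =
  row_mx (Q *m invmx N - s^-1 *: (r *m w^T)) (s^-1 *: r).
  rewrite mul_row_block mul_mx_scalar mulmxDr -!scalemxAr mulmxA; congr row_mx.
    by rewrite mulmxBl scalerBr opprB scaleNr addrA.
  by rewrite scaleNr addrC -scalerBr.
rewrite tr_row_mx mul_row_col mulmxBl -!scalemxAl -addrA; congr (_ + _).
by rewrite addrC -mulmxA -trmx_mul -scalerBr -mulmxBr -linearB.
Qed.

End Bordered.

Section KleinmichelCompact.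
Variables (R : realType) (n : nat) (H0 : 'M[R]_n).
Variables (d y : nat -> 'cV[R]_n) (gamma : nat -> R).

Local Notation H := (kleinmichel H0 d y gamma).
Local Notation gbar := (gamma_bar gamma).
Local Notation q := (qvec H0 d y gamma).
Local Notation Q := (Qmx H0 d y gamma).
Local Notation M := (Mmx H0 d y gamma).

Lemma inner_scalar_mx (u v : 'cV[R]_n) : (inner u v)%:M = u^T *m v.
Proof.
rewrite [RHS]mx11_scalar mxE; congr (_%:M).
by apply: eq_bigr => i _; rewrite mxE.
Qed.

Lemma gamma_barS j : gbar j.+1 = gamma j * gbar j.
Proof. by rewrite /gamma_bar big_ord_recr /= mulrC. Qed.

Lemma Qmx_recr j :
  Q j.+1 = castmx (erefl n, addn1 j) (row_mx (Q j) (q j)).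
Proof.
apply/matrixP => i l; rewrite castmxE /= cast_ord_id [LHS]mxE.
case: (split_ordP (cast_ord (esym (addn1 j)) l)) => l' El.
  have -> : nat_of_ord l = l' by move/(congr1 val): El.
  by rewrite El row_mxEl [RHS]mxE.
have -> : nat_of_ord l = j.
  by move/(congr1 val): El; rewrite /= (ord1 l') addn0.
by rewrite El row_mxEr (ord1 l').
Qed.

(** The recursion for [M], defined from size 1 on, also holds at size 0, where
    the three blocks other than the corner are empty. *)
Lemma Mmx_recr j :
  M j.+1 = castmx (addn1 j, addn1 j)
    (block_mx ((gamma j)^-1 *: M j) ((Q j)^T *m d j)
              ((Q j)^T *m d j)^T (inner (q j) (d j))%:M).
Proof.
case: j => [|j] //=.
have castE (a : 'I_1) : cast_ord (esym (addn1 0)) a = rshift 0 (0 : 'I_1).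
  by apply: val_inj; rewrite (ord1 a).
by apply/matrixP => a b; rewrite castmxE !castE block_mxEdr !ord1.
Qed.

(** The compact representation for nonzero [gamma j] and any number of updates,
    proved together with the symmetry of [M k], on which the inductive step
    depends. *)
Lemma kleinmichel_compact k :
  (forall j, (j < k)%N -> gamma j != 0) ->
  (forall j, (j < k)%N ->
     inner (y j - gamma j *: (H j *m d j)) (d j) != 0) ->
  [/\ M k \in unitmx, (M k)^T = M k &
      H k = gbar k *: H0 + Q k *m invmx (M k) *m (Q k)^T].
Proof.
elim: k => [|k IHk] g0 wd.
  split; first by rewrite unitmxE det_mx00 unitr1.
    by rewrite trmx0.
  rewrite /gamma_bar big_ord0 scale1r /=.
  by rewrite [Q 0 *m _]thinmx0 mul0mx addr0.
have [||uM symM Hk] := IHk.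
- by move=> j /ltnW; apply: g0.
- by move=> j /ltnW; apply: wd.
have gk := g0 k (ltnSn k); have {wd} := wd k (ltnSn k).
set r := y k - _; set s := inner r (d k) => s0.
set v := (Q k)^T *m d k; set w := gamma k *: (invmx (M k) *m v).
have uN : (gamma k)^-1 *: M k \in unitmx by rewrite unitmxZ // unitfE invr_eq0.
have symN : ((gamma k)^-1 *: M k)^T = (gamma k)^-1 *: M k.
  by rewrite linearZ /= symM.
have Nw : (gamma k)^-1 *: M k *m w = v.
  by rewrite -scalemxAl -scalemxAr scalerA mulVf // scale1r mulKVmx.
have rE : r = q k - Q k *m w.
  rewrite /r Hk mulmxDl scalerDr -scalemxAl scalerA -gamma_barS opprD addrA.
  by rewrite -scalemxAr !mulmxA.
have vw : v^T *m w = (inner (q k) (d k) - s)%:M.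
  rewrite raddfB /= !inner_scalar_mx rE [(_ - _ *m w)^T]linearB mulmxBl subKr /=.
  rewrite [(Q k *m w)^T]trmx_mul -mulmxA -/v.
  (* a 1 x 1 matrix equals its transpose *)
  have tr11 (A : 'M[R]_1) : A^T = A by rewrite [A]mx11_scalar tr_scalar_mx.
  by rewrite -[LHS]tr11 trmx_mul trmxK.
have [uB symB form] :=
  bordered_form (addn1 k) (Q k) (q k) uN symN s0 Nw vw.
rewrite Mmx_recr Qmx_recr; split=> //; rewrite form /= -rE.
rewrite invmxZ // invrK.
rewrite -/r -/s scalerDr scalerA invfM mulrA mulfV // mul1r.
by rewrite -/r {1}Hk gamma_barS scalerDr scalerA -scalemxAr -scalemxAl -addrA.
Qed.

End KleinmichelCompact.

Theorem theorem5p2 (R : realType) (n k : nat) (H0 : 'M[R]_n)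
    (d y : nat -> 'cV[R]_n) (gamma : nat -> R)
    (hk : (1 <= k)%N)
    (H0sym : H0^T = H0)
    (gamma_gt0 : forall j : nat, (j < k)%N -> 0 < gamma j)
    (well_defined : forall j : nat, (j < k)%N ->
       inner (y j - gamma j *: (kleinmichel H0 d y gamma j *m d j)) (d j) != 0) :
  Mmx H0 d y gamma k \in unitmx /\
  kleinmichel H0 d y gamma k =
    gamma_bar gamma k *: H0 +
    Qmx H0 d y gamma k *m invmx (Mmx H0 d y gamma k) *m (Qmx H0 d y gamma k)^T.
Proof.
have [j /gamma_gt0/lt0r_neq0 //|//|uM _ Hk] :=
  @kleinmichel_compact R n H0 d y gamma k.
by split.
Qed.
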